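(* Let $x_1,x_2$ be two operationally holonomic signals with $x_1x_2\neq0$, and let $X=x_1+x_2e^{-t_rs}$. Then $t_r$ is algebraic over the differential field $k_0(s)\langle X\rangle$.
   Context: $k_0$ is a commutative field of characteristic zero, and $k_0(s)$ is a differential field for $\frac{d}{ds}$ with field of constants $k_0$. $k_0(s)[\frac{d}{ds}]$ is the noncommutative ring of linear differential operators $\sum_{\text{finite}}\varrho_\alpha\frac{d^\alpha}{ds^\alpha}$, $\varrho_\alpha\in k_0(s)$. $k/k_0$ is a transcendental field extension; elements of $k$ are constants for $\frac{d}{ds}$ on $k(s)$. The delay $t_r\in k$ is transcendental over $k_0$. A signal $x$ is operationally holonomic if $\varpi x=0$ for some nonzero $\varpi\in k_0(s)[\frac{d}{ds}]$. Let $\bar K$ be the algebraic closure of $k_0(s)$, a differential field with field of constants the algebraic closure $\bar k_0$ of $k_0$; the signals are elements of a Picard–Vessiot extension $E$ of $\bar K$ (so $E$ has constants $\bar k_0$). All computations take place in a differential field containing $E$, $k(s)$ and the delay operator $e^{-t_rs}$, which is a nonzero element satisfying $\left(\frac{d}{ds}+t_r\right)e^{-t_rs}=0$. $k_0(s)\langle X\rangle$ denotes the differential overfield of $k_0(s)$ generated by $X$ (i.e. the field generated over $k_0(s)$ by $X$ and all its derivatives with respect to $s$). *)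

(* Defs.v *)
From HB Require Import structures.
From mathcomp Require Import all_boot all_order all_algebra.
From mathcomp Require Import fraction generic_quotient ring.

Set Implicit Arguments.
Unset Strict Implicit.
Unset Printing Implicit Defensive.

Import GRing.Theory.
Local Open Scope ring_scope.

HB.mixin Record isDifferential F of GRing.Field F := {
  der : F -> F;
  derD : {morph der : x y / x + y};
  derM : forall x y, der (x * y) = der x * y + x * der y
}.

#[short(type="diffFieldType")]
HB.structure Definition DiffField := { F of GRing.Field F & isDifferential F }.

(* F(s); the variable s is 'X%:F. *)
Notation ratfun F := {fraction {poly F}}.
Notation "x %:F" := (@FracField.tofrac _ x) (format "x %:F") : ring_scope.

Section RatfunDerivation.
Variable F : fieldType.
Implicit Types (p q : {poly F}) (x y : ratfun F).

(* The quotient rule for a chosen representative of x; by der_ratfunE it holds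
   for every representative. *)
Definition der_ratfun x : ratfun F :=
  let p := \n_(repr x) in let q := \d_(repr x) in
  (p^`() * q - p * q^`())%:F / (q ^+ 2)%:F.

Lemma ratfun_repr x : x = (\n_(repr x))%:F / (\d_(repr x))%:F.
Proof.
have q0 : \d_(repr x) != 0 by exact: denom_ratioP.
have qF : (\d_(repr x))%:F != 0 by rewrite tofrac_eq0.
apply: (mulIf qF); rewrite divfK //.
rewrite -{1}[x]reprK; unlock FracField.tofrac.
rewrite -[LHS]FracField.pi_mul; apply/eqmodP => /=.
rewrite FracField.equivfE /FracField.mulf !numden_Ratio ?oner_eq0 ?mulf_neq0 //.
  by rewrite !mulr1 mulrC.
all: exact: oner_neq0.
Qed.

Lemma der_ratfunE p q : q != 0 ->
  der_ratfun (p%:F / q%:F) = (p^`() * q - p * q^`())%:F / (q ^+ 2)%:F.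
Proof.
move=> q0; rewrite /der_ratfun; set x := p%:F / q%:F.
set a := \n_(repr x); set b := \d_(repr x).
have b0 : b != 0 by exact: denom_ratioP.
have ab : a * q = p * b.
  apply/eqP; rewrite -tofrac_eq !tofracM; apply/eqP.
  have := ratfun_repr x; rewrite -/a -/b {1}/x => /eqP.
  by rewrite eqr_div ?tofrac_eq0 // => /eqP ->.
have dab : a^`() * q + a * q^`() = p^`() * b + p * b^`() by rewrite -!derivM ab.
apply/eqP; rewrite eqr_div ?tofrac_eq0 ?expf_neq0 // -!tofracM tofrac_eq.
apply/eqP.
have -> : (a^`() * b - a * b^`()) * q ^+ 2 =
  (a^`() * q + a * q^`()) * (b * q) - (a * q) * (b * q^`() + b^`() * q) by ring.
by rewrite dab ab; ring.
Qed.

Lemma der_ratfunD : {morph der_ratfun : x y / x + y}.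
Proof.
move=> x y; rewrite [x]ratfun_repr [y]ratfun_repr.
have b0 := denom_ratioP (repr x); have e0 := denom_ratioP (repr y).
have be0 := mulf_neq0 b0 e0.
rewrite addf_div ?tofrac_eq0 // -!tofracM -tofracD !der_ratfunE //.
rewrite addf_div ?tofrac_eq0 ?expf_neq0 // -!tofracM -tofracD exprMn.
by congr (_%:F / _); rewrite derivD !derivM; ring.
Qed.

Lemma der_ratfunM x y :
  der_ratfun (x * y) = der_ratfun x * y + x * der_ratfun y.
Proof.
rewrite [x]ratfun_repr [y]ratfun_repr.
set a := \n_(repr x); set b := \d_(repr x).
set c := \n_(repr y); set e := \d_(repr y).
have b0 : b != 0 by exact: denom_ratioP.
have e0 : e != 0 by exact: denom_ratioP.
rewrite mulf_div -!tofracM !der_ratfunE ?mulf_neq0 // !mulf_div -!tofracM.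
rewrite addf_div ?tofrac_eq0 ?mulf_neq0 ?expf_neq0 // -!tofracM -tofracD.
apply/eqP; rewrite eqr_div ?tofrac_eq0 ?mulf_neq0 ?expf_neq0 ?mulf_neq0 //.
by rewrite -!tofracM tofrac_eq; apply/eqP; rewrite !derivM; ring.
Qed.

Lemma der_tofrac p : der_ratfun p%:F = (p^`())%:F.
Proof.
rewrite -[p%:F]divr1 -(tofrac1 {poly F}) der_ratfunE ?oner_neq0 //.
by rewrite expr1n derivC mulr0 subr0 mulr1 tofrac1 divr1.
Qed.

HB.instance Definition _ :=
  isDifferential.Build (ratfun F) der_ratfunD der_ratfunM.

End RatfunDerivation.

Section DifferentialExtensions.
Variables (K L : diffFieldType) (i : K -> L).

(* The operator \sum_m p_m (d/ds)^m with coefficients in K, acting on L.  Only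
   the left K-vector space underlying K[d/ds] is used, never the product of
   {poly K}. *)
Definition diffop (p : {poly K}) (x : L) : L :=
  \sum_(m < size p) i p`_m * iter m der x.

Definition holonomic (x : L) : Prop :=
  exists2 p : {poly K}, p != 0 & diffop p x = 0.

Definition is_subfield (P : L -> Prop) : Prop :=
  [/\ P 1, forall x y, P x -> P y -> P (x - y)
     & forall x y, P x -> P y -> P (x / y)].

(* K<S>, the field generated over i(K) by the elements of S and all their
   derivatives. *)
Definition diff_gen (S : L -> Prop) (z : L) : Prop :=
  forall P : L -> Prop, is_subfield P ->
    (forall a, P (i a)) ->
    (forall u m, S u -> P (iter m der u)) ->
  P z.

(* L is generated over K by a basis y of solutions of a linear differential
   equation of order n with coefficients in K, the y_j being linearly
   independent over the constants of L, and L has no constants other than those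
   of K. *)
Definition picard_vessiot : Prop :=
  exists (n : nat) (p : {poly K}) (y : 'I_n -> L),
  [/\ size p = n.+1,
      forall j, diffop p (y j) = 0,
      forall c : 'I_n -> L, (forall j, der (c j) = 0) ->
        \sum_j c j * y j = 0 -> forall j, c j = 0,
      forall z, diff_gen (fun u => exists j, u = y j) z
    & forall c : L, der c = 0 -> exists2 c0 : K, der c0 = 0 & i c0 = c].

End DifferentialExtensions.

Definition algebraic_closure (K L : fieldType) (i : {rmorphism K -> L}) : Prop :=
  (forall x, algebraicOver i x) /\ GRing.closed_field_axiom L.

(* algebraicOver needs a fieldType as ground field; here it is a subset of L. *)
Definition algebraic_over (L : fieldType) (P : L -> Prop) (t : L) : Prop :=
  exists p : {poly L}, [/\ p != 0, forall n, P p`_n & root p t].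

(* Main.v *)
Require Import Defs.
From HB Require Import structures.
From mathcomp Require Import all_boot all_order all_algebra.
From mathcomp Require Import fraction ring.

Set Implicit Arguments.
Unset Strict Implicit.
Unset Printing Implicit Defensive.

Import GRing.Theory.
Local Open Scope ring_scope.

(** Write t for the delay, e for the delay operator, so that t' = 0 and
    e' = - t e, and K = k0(s).

    The signal x1 and its derivatives span a finite-dimensional K-space, and so
    do x2 and its derivatives.  Since (v e)' = (v' - t v) e, the derivatives of
    x2 e stay in the K[t]-module generated by finitely many products v e.
    Hence all derivatives of X = x1 + x2 e lie in a finitely generated
    K[t]-module, and linear algebra over the domain K[T] gives a relation
      \sum_m p_m(t) X^(m) = 0  with p_m in K[T] not all zero
    ([dfinite_relation]).  Reordered by powers of t, it is a polynomial
    equation for t whose coefficients D_j X lie in K<X>, where the D_j are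
    operators over K that are not all zero.  If the equation is trivial, then
    some nonzero D_j kills X, so X is holonomic
    ([relation_algebraic_over]).

    It remains to see that X is not holonomic.  Otherwise x2 e = X - x1 would
    be holonomic too.  Conjugating by e turns d/ds into d/ds - t, so an
    operator of order M over K that kills x2 e becomes, after division by e, a
    polynomial in t over E with leading coefficient a nonzero multiple of x2:
    t is algebraic over E ([holonomic_mul_exp_algebraic]).  A constant that is
    algebraic over a differential field is algebraic over its constants
    ([algebraic_over_constants]).  The constants of E are those of the
    algebraic closure of K, because E is a Picard-Vessiot extension; those are
    algebraic over the constants of K ([algebraic_constant_integral]); and
    these are the elements of k0, in characteristic zero ([constant_ratfun]).
    So t would be algebraic over k0, which is excluded. *)

(** * Derivations and polynomials *)

Section Derivations.
Variable F : diffFieldType.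

Lemma der_is_zmod_morphism : zmod_morphism (@der F).
Proof.
by move=> x y; apply/esym/eqP; rewrite subr_eq -derD subrK.
Qed.

HB.instance Definition _ :=
  GRing.isZmodMorphism.Build F F (@der F) der_is_zmod_morphism.

Lemma der1 : der (1 : F) = 0.
Proof.
have := derM (1 : F) 1; rewrite !mulr1 mul1r => /eqP.
by rewrite -subr_eq0 opprD addNKr oppr_eq0 => /eqP.
Qed.

Lemma der_horner (P : {poly F}) (t : F) :
  der t = 0 -> der P.[t] = (map_poly der P).[t].
Proof.
move=> dt; elim/poly_ind: P => [|P c IH].
  by rewrite raddf0 !horner0 raddf0.
have -> : map_poly der (P * 'X + c%:P) = map_poly der P * 'X + (der c)%:P.
  apply/polyP=> -[|n]; rewrite coef_map !(coefD, coefMX, coefC) /=.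
    by rewrite !add0r.
  by rewrite !addr0 coef_map.
by rewrite !hornerMXaddC derD derM dt mulr0 addr0 IH.
Qed.

Lemma der_root (P : {poly F}) (t : F) :
  der t = 0 -> root P t -> root (map_poly der P) t.
Proof.
by move=> dt /rootP Pt; apply/rootP; rewrite -der_horner // Pt raddf0.
Qed.

(** The leading coefficient 1 is a constant, so differentiating the
    coefficients lowers the degree. *)
Lemma size_der_monic (P : {poly F}) :
  P \is monic -> (size (map_poly der P) < size P)%N.
Proof.
move=> mP; have sP : (0 < size P)%N by rewrite size_poly_gt0 monic_neq0.
rewrite -(prednK sP) ltnS; apply/leq_sizeP => j; rewrite leq_eqVlt coef_map /=.
case/orP => [/eqP <-|lt_j]; first by rewrite -lead_coefE (monicP mP) der1.
by rewrite nth_default ?raddf0 // -(prednK sP).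
Qed.

End Derivations.

Section Morphisms.
Variables (K L : diffFieldType) (f : {rmorphism K -> L}).
Hypothesis f_der : {morph f : x / der x >-> der x}.

Lemma rmorph_iter_der m x : f (iter m der x) = iter m der (f x).
Proof. by elim: m => //= m IH; rewrite f_der IH. Qed.

Lemma map_poly_der (P : {poly K}) :
  map_poly der (map_poly f P) = map_poly f (map_poly der P).
Proof. by apply/polyP=> j; rewrite !coef_map /= f_der. Qed.

(** Differentiating the coefficients of a monic polynomial with root t gives a
    polynomial of smaller degree that still has the root t.  Iterating, with
    renormalization, must end at a monic polynomial whose coefficients are all
    constants. *)
Lemma algebraic_over_constants (t : L) : der t = 0 -> algebraicOver f t ->
  exists2 P : {poly K}, P \is monic /\ map_poly der P = 0
                      & root (map_poly f P) t.
Proof.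
move=> dt [P]; have [n] := ubnP (size P).
elim: n P => // n IH P le_P P0 Pt.
pose Q := (lead_coef P)^-1 *: P.
have c0 : (lead_coef P)^-1 != 0 by rewrite invr_eq0 lead_coef_eq0.
have mQ : Q \is monic by rewrite monicE lead_coefZ mulVf // lead_coef_eq0.
have Qt : root (map_poly f Q) t by rewrite map_polyZ rootZ ?fmorph_eq0.
have [dQ0|dQ0] := eqVneq (map_poly der Q) 0; first by exists Q.
apply: IH dQ0 _; last by rewrite -map_poly_der; apply: der_root.
by apply: leq_trans (size_der_monic mQ) _; rewrite size_scale.
Qed.

Lemma holonomic_map (K0 : diffFieldType) (i : K0 -> K) (x : K) :
  holonomic i x -> holonomic (f \o i) (f x).
Proof.
case=> p p0 px; exists p => //; rewrite /diffop.
rewrite -[RHS](rmorph0 f) -px rmorph_sum.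
by apply: eq_bigr => m _; rewrite rmorphM rmorph_iter_der.
Qed.

End Morphisms.

(** * The constants of F(s) in characteristic zero *)

Section Constants.
Variable F : fieldType.
Hypothesis char0 : [pchar F] =i pred0.

Lemma natr_inj_char0 : injective (fun n => n%:R : F).
Proof.
have inj m n : (m <= n)%N -> m%:R = n%:R :> F -> m = n.
  move=> le_mn /eqP; rewrite eq_sym -subr_eq0 -natrB // (GRing.pcharf0P _).1 //.
  by rewrite subn_eq0 => le_nm; apply/eqP; rewrite eqn_leq le_mn.
move=> m n /= mn; case/orP: (leq_total m n) => [le|le]; first exact: inj le mn.
exact/esym/inj.
Qed.

Lemma lead_coef_deriv_char0 (p : {poly F}) :
  lead_coef p^`() = lead_coef p *+ (size p).-1.
Proof.
case sp: (size p) => [|[|n]] /=; 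
  [| |have p0 : p != 0 by rewrite -size_poly_gt0 sp].
- by move/eqP: sp; rewrite size_poly_eq0 => /eqP->; rewrite deriv0 lead_coef0.
- by rewrite [p]size1_polyC ?sp // derivC lead_coef0.
have top : p^`()`_n = lead_coef p *+ n.+1 by rewrite coef_deriv lead_coefE sp.
have top0 : p^`()`_n != 0.
  rewrite top -mulr_natr mulf_neq0 ?lead_coef_eq0 //.
  by rewrite (GRing.pcharf0P _).1.
have /eqP sd : size p^`() == n.+1.
  rewrite eqn_leq -ltnS -sp lt_size_deriv //= ltnNge.
  by apply: contra top0 => le; rewrite nth_default.
by rewrite lead_coefE sd.
Qed.

(** Comparing leading coefficients of the two sides gives deg p = deg q in F,
    hence in nat since F has characteristic zero. *)
Lemma wronskian0_size (p q : {poly F}) :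
  p != 0 -> q != 0 -> p^`() * q = p * q^`() -> size p = size q.
Proof.
move=> p0 q0 /(congr1 lead_coef); rewrite !lead_coefM !lead_coef_deriv_char0.
rewrite mulrnAl mulrnAr -mulr_natr -[RHS]mulr_natr => /mulfI eq_pq.
rewrite -[LHS]prednK ?size_poly_gt0 // -[RHS]prednK ?size_poly_gt0 //.
by congr _.+1; apply/natr_inj_char0/eq_pq; rewrite mulf_neq0 ?lead_coef_eq0.
Qed.

(** If p / q is a nonzero constant and c is the quotient of the leading coefficients,
    then (p - c q) / q is a constant as well.  Its numerator has smaller degree
    than q, since p and q have equal degrees, so it must be zero. *)
Lemma constant_ratfun (x : ratfun F) : der x = 0 -> exists c, x = (c%:P)%:F.
Proof.
rewrite [x]ratfun_repr; set p := \n_(repr x); set q := \d_(repr x).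
have q0 : q != 0 by exact: denom_ratioP.
have qF : q%:F != 0 by rewrite tofrac_eq0.
rewrite [der _]der_ratfunE // => /eqP; rewrite mulf_eq0 invr_eq0.
rewrite !tofrac_eq0 expf_eq0 (negPf q0) /= orbF.  rewrite subr_eq0 => /eqP dpq.
pose c := lead_coef p / lead_coef q; exists c.
suff : p - c *: q == 0.
  by rewrite subr_eq0 => /eqP ->; rewrite -mul_polyC tofracM mulfK.
apply/contraT => r0.
have [p0|p0] := eqVneq p 0.
  by move: r0; rewrite /c p0 lead_coef0 mul0r scale0r subr0 eqxx.
have spq := wronskian0_size p0 q0 dpq.
have : size (p - c *: q) = size q.
  apply: wronskian0_size => //.
  by rewrite derivB derivZ !mulrBl dpq -scalerAl -scalerAl [q^`() * q]mulrC.
move=> sr; have : lead_coef (p - c *: q) == 0.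
  rewrite lead_coefE sr coefB coefZ -{1}spq -!lead_coefE divfK ?subrr //.
  by rewrite lead_coef_eq0.
by rewrite lead_coef_eq0 (negPf r0).
Qed.

End Constants.

(** * Finitely generated differential modules *)

Section Span.
Variables (R : idomainType) (L : diffFieldType) (phi : {rmorphism R -> L}).

Definition span n (v : 'I_n -> L) (u : L) : Prop :=
  exists c : 'I_n -> R, u = \sum_j phi (c j) * v j.

(** For R = K this is finite dimension of the span of the derivatives of u.
    With a larger module, whose generators are only required to have their
    derivatives in it, the effect of sums and of multiplication by e can be read
    off the generators. *)
Definition dfinite (u : L) : Prop :=
  exists n (v : 'I_n -> L), span v u /\ forall j, span v (der (v j)).

Section Family.
Variables (n : nat) (v : 'I_n -> L).

Lemma span_family j : span v (v j).
Proof.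
exists (fun l => (l == j)%:R); rewrite (bigD1 j) //= eqxx rmorph1 mul1r.
by rewrite big1 ?addr0 // => l /negPf->; rewrite rmorph0 mul0r.
Qed.

Lemma spanD u w : span v u -> span v w -> span v (u + w).
Proof.
move=> [c ->] [d ->]; exists (fun j => c j + d j).
by rewrite -big_split; apply: eq_bigr => j _; rewrite rmorphD mulrDl.
Qed.

Lemma spanZ a u : span v u -> span v (phi a * u).
Proof.
case=> c ->; exists (fun j => a * c j).
by rewrite mulr_sumr; apply: eq_bigr => j _; rewrite rmorphM mulrA.
Qed.

Lemma span_sum m (F : 'I_m -> L) :
  (forall j, span v (F j)) -> span v (\sum_j F j).
Proof.
move=> sF; elim/big_rec: _ => [|j x _ sx]; last exact: spanD.
by exists (fun=> 0); rewrite big1 // => j _; rewrite rmorph0 mul0r.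
Qed.

Lemma span_trans m (w : 'I_m -> L) u :
  span w u -> (forall j, span v (w j)) -> span v u.
Proof. by case=> c -> sw; apply: span_sum => j; apply: spanZ. Qed.

End Family.

Lemma dfiniteN u : dfinite u -> dfinite (- u).
Proof.
case=> n [v [su sv]]; exists n, v; split=> //.
by have := spanZ (-1) su; rewrite rmorphN1 mulN1r.
Qed.

Lemma dfiniteD u w : dfinite u -> dfinite w -> dfinite (u + w).
Proof.
case=> n [v [su sv]] [m [z [sw sz]]].
pose y (j : 'I_(n + m)) := match split j with inl a => v a | inr b => z b end.
have yl a : span y (v a).
  have := span_family y (lshift m a); rewrite /y.
  by case: splitP => b /= => [/ord_inj->//|/eqP]; rewrite ltn_eqF ?ltn_addr.
have yr b : span y (z b).
  have := span_family y (rshift n b); rewrite /y.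
  by case: splitP => a /= => [/eqP|/addnI/ord_inj->//]; rewrite gtn_eqF ?ltn_addr.
exists (n + m)%N, y; split.
  by apply: spanD; [apply: span_trans su _ | apply: span_trans sw _].
move=> j; rewrite {2}/y; case: splitP => a _.
  exact: span_trans (sv a) _.
exact: span_trans (sz a) _.
Qed.

Lemma sum_coef_widen (p : {poly R}) N (F : nat -> L) : (size p <= N)%N ->
  \sum_(m < size p) phi p`_m * F m = \sum_(m < N) phi p`_m * F m.
Proof.
move=> le_p; rewrite (big_ord_widen N (fun m => phi p`_m * F m)) // big_mkcond.
apply: eq_bigr => m _; case: ltnP => // le_m.
by rewrite nth_default // rmorph0 mul0r.
Qed.

(** The n + 1 vectors of coordinates of u, u', ..., u^(n) in the n generators
    are linearly dependent over the domain R. *)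
Lemma dfinite_relation u :
  (forall a, exists b, der (phi a) = phi b) -> dfinite u ->
  exists2 p : {poly R}, p != 0
    & \sum_(m < size p) phi p`_m * iter m der u = 0.
Proof.
move=> phi_der [n [v [su sv]]].
have span_der w : span v w -> span v (der w).
  case=> c ->; rewrite raddf_sum; apply: span_sum => j /=.
  rewrite derM; apply: spanD; last exact: spanZ.
  by have [b ->] := phi_der (c j); apply: spanZ; apply: span_family.
have span_iter m : span v (iter m der u) by elim: m => //= m; apply: span_der.
have [c cE] := fin_all_exists (fun m : 'I_n.+1 => span_iter m).
(* Padding the (n + 1) x n matrix of coordinates with a zero column makes it
   square and singular. *)
pose A := \matrix_(m < n.+1, j < n.+1)
  if unlift ord_max j is Some j' then c m j' else 0.
have /eqP/det0P[a a0 aA] : \det A = 0.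
  rewrite (expand_det_col A ord_max) big1 // => m _.
  by rewrite mxE unlift_none mul0r.
exists (rVpoly a).
  by apply: contraNneq a0 => ra; rewrite -[a]rVpolyK ra raddf0.
rewrite (sum_coef_widen (fun m => iter m der u) (size_poly _ _)).
under eq_bigr => m _ do rewrite coef_rVpoly_ord cE mulr_sumr.
rewrite exchange_big big1 //= => j _.
under eq_bigr => m _ do rewrite mulrA -rmorphM.
rewrite -mulr_suml -rmorph_sum -[RHS](mul0r (v j)) -(rmorph0 phi).
congr (phi _ * _).
have /matrixP/(_ 0 (lift ord_max j)) := aA; rewrite !mxE => aAj.
by rewrite -[RHS]aAj; apply: eq_bigr => m _; rewrite mxE liftK.
Qed.

End Span.

(** * Holonomic elements over a differential field *)

Section Holonomic.
Variables (K L : diffFieldType) (g : {rmorphism K -> L}).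
Hypothesis g_der : {morph g : x / der x >-> der x}.

(** An equation of order n expresses x^(n) through x, ..., x^(n-1), so these n
    derivatives are generators closed under derivation. *)
Lemma holonomic_dfinite x : holonomic g x -> dfinite g x.
Proof.
case=> p p0; rewrite /diffop.
have sp : (0 < size p)%N by rewrite size_poly_gt0.
have l0 : lead_coef p != 0 by rewrite lead_coef_eq0.
move: l0 sp; rewrite lead_coefE; case: (size p) => //= n l0 _.
rewrite big_ord_recr /= => /eqP; rewrite addrC addr_eq0 => /eqP pE.
pose v (j : 'I_n) := iter j der x.
have top : span g v (iter n der x).
  have -> : iter n der x = g (- (p`_n)^-1) * \sum_(m < n) g p`_m * iter m der x.
    rewrite rmorphN mulNr -mulrN -pE mulrA -rmorphM mulVf // rmorph1.
    by rewrite mul1r.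
  by apply/spanZ/span_sum => j; apply/spanZ/span_family.
have all m : (m <= n)%N -> span g v (iter m der x).
  rewrite leq_eqVlt => /orP[/eqP->//|lt_m].
  exact: (span_family g v (Ordinal lt_m)).
by exists n, v; split=> [|j]; [apply: (all 0) | apply: (all j.+1)].
Qed.

Lemma dfinite_holonomic x : dfinite g x -> holonomic g x.
Proof. by apply: dfinite_relation => a; exists (der a); rewrite g_der. Qed.

End Holonomic.

(** * Multiplication by an exponential *)

Section Exponential.
Variables (K L : diffFieldType) (f : {rmorphism K -> L}).
Hypothesis f_der : {morph f : x / der x >-> der x}.
Variables (t e : L).
Hypotheses (t_const : der t = 0) (e_der : der e = - (t * e)).

Definition map_horner : {rmorphism {poly K} -> L} := (horner_eval t \o map_poly f).

Lemma map_hornerE P : map_horner P = (map_poly f P).[t].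
Proof. by []. Qed.

Lemma der_map_horner P : der (map_horner P) = map_horner (map_poly der P).
Proof. by rewrite !map_hornerE der_horner // map_poly_der. Qed.

Lemma map_hornerC c : map_horner c%:P = f c.
Proof. by rewrite map_hornerE map_polyC hornerC. Qed.

Lemma map_hornerX : map_horner 'X = t.
Proof. by rewrite map_hornerE map_polyX hornerX. Qed.

Lemma dfinite_map_horner x : dfinite f x -> dfinite map_horner x.
Proof.
have sub n (v : 'I_n -> L) u : span f v u -> span map_horner v u.
  case=> c ->; exists (fun j => (c j)%:P).
  by apply: eq_bigr => j _; rewrite map_hornerC.
by case=> n [v [su sv]]; exists n, v; split=> [|j]; apply: sub.
Qed.

Lemma dfinite_mul_exp x : dfinite map_horner x -> dfinite map_horner (x * e).
Proof.
case=> n [v [sx sv]]; pose w j := v j * e.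
have sub u : span map_horner v u -> span map_horner w (u * e).
  case=> c ->; exists c; rewrite mulr_suml.
  by apply: eq_bigr => j _; rewrite mulrA.
exists n, w; split=> [|j]; first exact: sub.
rewrite derM e_der; apply: spanD; first exact: sub.
have -> : v j * - (t * e) = map_horner (- 'X) * w j.
  by rewrite rmorphN map_hornerX /w; ring.
exact/spanZ/span_family.
Qed.

(** The derivation on polynomials in t that corresponds to d/ds after
    factoring out e: it is d/ds - t, with t replaced by the indeterminate. *)
Definition twist (P : {poly K}) : {poly K} := map_poly der P - P * 'X.

Lemma der_mul_exp P : der (map_horner P * e) = map_horner (twist P) * e.
Proof.
by rewrite derM e_der der_map_horner /twist rmorphB rmorphM map_hornerX; ring.
Qed.

Lemma size_twist P : P != 0 -> size (twist P) = (size P).+1.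
Proof.
move=> P0; rewrite /twist addrC size_polyDl size_polyN size_mulX //.
by rewrite ltnS size_poly.
Qed.

Lemma size_iter_twist x m : x != 0 -> size (iter m twist x%:P) = m.+1.
Proof.
move=> x0; elim: m => [|m IH] /=; first by rewrite size_polyC x0.
by rewrite size_twist ?IH // -size_poly_gt0 IH.
Qed.

Lemma iter_der_mul_exp x m :
  iter m der (f x * e) = map_horner (iter m twist x%:P) * e.
Proof.
elim: m => [|m IH]; first by rewrite map_hornerC.
by rewrite !iterS IH der_mul_exp.
Qed.

(** After division by e, the equation \sum_m p_m (x e)^(m) = 0 reads
    \sum_m p_m P_m(t) = 0, where P_m = twist^m(x).  As P_m has degree m in the
    indeterminate, the term of highest order dominates, and the polynomial with
    root t is nonzero. *)
Lemma holonomic_mul_exp_algebraic (K0 : diffFieldType)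
    (i : {rmorphism K0 -> K}) x :
  e != 0 -> x != 0 -> holonomic (f \o i) (f x * e) -> algebraicOver f t.
Proof.
move=> e0 x0 [p p0]; rewrite /diffop => px.
exists (\sum_(m < size p) i p`_m *: iter m twist x%:P); last first.
  apply/rootP; apply: (mulIf e0); rewrite mul0r -[RHS]px -map_hornerE rmorph_sum.
  rewrite mulr_suml; apply: eq_bigr => m _.
  by rewrite iter_der_mul_exp -mul_polyC rmorphM map_hornerC mulrA.
have sp : (0 < size p)%N by rewrite size_poly_gt0.
have l0 : lead_coef p != 0 by rewrite lead_coef_eq0.
move: l0 sp; rewrite lead_coefE; case: (size p) => //= n l0 _.
rewrite big_ord_recr /= addrC -size_poly_gt0 size_polyDl.
  by rewrite size_scale ?fmorph_eq0 // size_iter_twist.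
rewrite size_scale ?fmorph_eq0 // size_iter_twist // ltnS.
apply: leq_trans (size_sum _ _ _) _; apply/bigmax_leqP => m _.
by apply: leq_trans (size_scale_leq _ _) _; rewrite size_iter_twist.
Qed.

End Exponential.

(** * From a relation over K[t] to an equation for t *)

Section Nonholonomic.
Variables (K L : diffFieldType) (g : {rmorphism K -> L}) (t X : L).

(** The coefficient of T^j in the reordered relation is D_j X, where D_j has as
    coefficients the coefficients of T^j in the p_m.  Each D_j X lies in
    K<X>. *)
Lemma relation_algebraic_over (p : {poly {poly K}}) : p != 0 ->
  \sum_(m < size p) map_horner g t p`_m * iter m der X = 0 -> ~ holonomic g X ->
  algebraic_over (diff_gen g (fun u => u = X)) t.
Proof.
move=> p0 pX nhX.
pose P := \sum_(m < size p) map_poly g p`_m * (iter m der X)%:P.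
have coefP j : P`_j = \sum_(m < size p) g p`_m`_j * iter m der X.
  by rewrite coef_sum; apply: eq_bigr => m _; rewrite coefMC coef_map.
(* P`_j is D_j X; if all of them vanish, a nonzero D_j shows that X is
   holonomic. *)
exists P; split; last first.
- apply/rootP; rewrite -[RHS]pX horner_sum; apply: eq_bigr => m _.
  by rewrite hornerM hornerC -map_hornerE.
- move=> j Q [Q1 QB Qdiv] Qg QX; rewrite coefP.
  have Q0 : Q 0 by rewrite -(subrr (1 : L)); apply: QB.
  have QD a b : Q a -> Q b -> Q (a + b).
    by move=> Qa Qb; rewrite -[b]opprK -[- b]sub0r; apply/QB/QB.
  have QM a b : Q a -> Q b -> Q (a * b).
    by move=> Qa Qb; rewrite -[b]invrK -[b^-1]div1r; apply/Qdiv/Qdiv.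
  elim/big_rec: _ => // m a _ Qa; apply: QD => //; apply: QM => //.
  exact: QX.
apply/eqP=> P0; apply: nhX.
have [j qj0] : exists j, (lead_coef p)`_j != 0.
  by exists (size (lead_coef p)).-1; rewrite -lead_coefE !lead_coef_eq0.
exists (\poly_(m < size p) p`_m`_j).
  apply: contraNneq qj0 => /polyP/(_ (size p).-1).
  by rewrite coef_poly coef0 ltn_predL size_poly_gt0 p0 lead_coefE => ->.
rewrite /diffop (sum_coef_widen g (fun m => iter m der X) (size_poly _ _)).
rewrite -[RHS](coef0 _ j) -P0 coefP; apply: eq_bigr => m _.
by rewrite coef_poly ltn_ord.
Qed.

End Nonholonomic.

(** * Algebraicity of the delay *)

Definition ratfun_const (F : fieldType) : {rmorphism F -> ratfun F} :=
  (@FracField.tofrac {poly F} \o polyC).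

(** The constants of an algebraic extension of F(s) are algebraic over the
    constants of F(s), which are the elements of F. *)
Lemma algebraic_constant_integral (F : fieldType) (char0 : [pchar F] =i pred0)
    (K : diffFieldType) (i : {rmorphism ratfun F -> K})
    (i_der : {morph i : x / der x >-> der x}) (c : K) :
  der c = 0 -> algebraicOver i c -> integralOver (i \o ratfun_const F) c.
Proof.
move=> dc /(algebraic_over_constants i_der dc)[P [mP dP] Pc].
apply: integral_root_monic Pc _; first exact: monic_map.
apply/integral_poly => j; rewrite coef_map.
have [a ->] : exists a, P`_j = ratfun_const F a.
  by apply: (constant_ratfun char0); move/polyP/(_ j): dP; rewrite coef_map coef0.
exact: (integral_id (i \o ratfun_const F)).
Qed.

Theorem corollary3
  (k0 k : fieldType) (char0 : [pchar k0] =i pred0)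
  (iota : {rmorphism k0 -> k})
  (tr : k) (tr_transc : ~ algebraicOver iota tr)
  (* the algebraic closure of k0(s) *)
  (Kbar : diffFieldType) (toK : {rmorphism ratfun k0 -> Kbar})
  (toK_der : {morph toK : x / der x >-> der x})
  (Kbar_closure : algebraic_closure toK)
  (* the Picard-Vessiot extension E of Kbar *)
  (E : diffFieldType) (toE : {rmorphism Kbar -> E})
  (toE_der : {morph toE : x / der x >-> der x})
  (E_PV : picard_vessiot toE)
  (* the ambient differential field, containing E and k(s) over k0(s) *)
  (Om : diffFieldType)
  (fE : {rmorphism E -> Om}) (fE_der : {morph fE : x / der x >-> der x})
  (fk : {rmorphism ratfun k -> Om}) (fk_der : {morph fk : x / der x >-> der x})
  (fEk : forall p : {poly k0},
     fE (toE (toK p%:F)) = fk (map_poly iota p)%:F)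
  (* the delay operator e^{- tr s} *)
  (delay : Om) (delay_neq0 : delay != 0)
  (delay_der : der delay + fk (tr%:P)%:F * delay = 0)
  (x1 x2 : E)
  (x1_hol : holonomic (fun a : ratfun k0 => toE (toK a)) x1)
  (x2_hol : holonomic (fun a : ratfun k0 => toE (toK a)) x2)
  (x12_neq0 : x1 * x2 != 0) :
  let X := fE x1 + fE x2 * delay in
  algebraic_over
    (diff_gen (fun a : ratfun k0 => fE (toE (toK a))) (fun u => u = X))
    (fk (tr%:P)%:F).
Proof.
move=> X; set t := fk _.
pose i : {rmorphism ratfun k0 -> E} := (toE \o toK).
pose g : {rmorphism ratfun k0 -> Om} := (fE \o i).
have g_der : {morph g : x / der x >-> der x}.
  by move=> a; rewrite /g /= toK_der toE_der fE_der.
have dt : der t = 0 by rewrite -fk_der [der _]der_tofrac derivC tofrac0 rmorph0.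
have e_der : der delay = - (t * delay).
  by apply/eqP; rewrite -addr_eq0 delay_der.
have x2_neq0 : x2 != 0 by move: x12_neq0; rewrite mulf_eq0 negb_or => /andP[].
have fin1 : dfinite g (fE x1).
  exact/holonomic_dfinite/(holonomic_map fE_der x1_hol).
have fin2 : dfinite g (fE x2).
  exact/holonomic_dfinite/(holonomic_map fE_der x2_hol).
have finX : dfinite (map_horner g t) X.
  apply: dfiniteD; first exact: dfinite_map_horner.
  by apply: dfinite_mul_exp => //; apply: dfinite_map_horner.
have [p p0 pX] : exists2 p : {poly {poly ratfun k0}}, p != 0
    & \sum_(m < size p) map_horner g t p`_m * iter m der X = 0.
  apply: dfinite_relation finX => P; exists (map_poly der P).
  exact: der_map_horner.
apply: (relation_algebraic_over p0 pX) => hX; apply: tr_transc.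
have hx2 : holonomic g (fE x2 * delay).
  apply: dfinite_holonomic => //.
  have -> : fE x2 * delay = X + - fE x1 by rewrite /X [fE x1 + _]addrC addrK.
  apply: dfiniteD; first exact: holonomic_dfinite.
  exact: dfiniteN.
have alg_t : algebraicOver fE t.
  exact: (holonomic_mul_exp_algebraic fE_der dt e_der delay_neq0 x2_neq0 hx2).
have [P [mP dP] Pt] := algebraic_over_constants fE_der dt alg_t.
pose h : {rmorphism k0 -> Om} := (fE \o (toE \o (toK \o ratfun_const k0))).
have /(integral_algebraic h)[Q Q0 Qt] : integralOver h t.
  apply: integral_root_monic Pt _; first exact: monic_map.
  apply/integral_poly => j; rewrite coef_map.
  have [_ [_ [_ [_ _ _ _ noconst]]]] := E_PV.
  have [c dc <-] : exists2 c : Kbar, der c = 0 & toE c = P`_j.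
    by apply: noconst; move/polyP/(_ j): dP; rewrite coef_map coef0.
  apply: integral_rmorph; apply: integral_rmorph.
  exact: algebraic_constant_integral (Kbar_closure.1 c).
exists Q => //; move: Qt.
have -> : map_poly h Q = map_poly (fk \o ratfun_const k) (map_poly iota Q).
  apply/polyP => j; rewrite !coef_map /=.
  by rewrite fEk map_polyC.
by rewrite (fmorph_root (fk \o ratfun_const k)).
Qed.
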